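(* Let $\mathbb{O}$ be the algebra of octonions, and let $S^{6}\subset \operatorname{Im}\mathbb{O}$ be the sphere of imaginary octonions of norm one, where for each $a\in S^{6}$ the tangent space $T_{a}S^{6}$ is identified with the orthogonal complement in $\mathbb{O}$ of the plane spanned by $1$ and $a$. Let $J$ be the almost complex structure on $S^{6}$ given by right multiplication, $J_{a}(b)=b\cdot a$ for $a\in S^{6}$ and $b\in T_{a}S^{6}$, and let $N$ be its Nijenhuis tensor, defined on vector fields $X,Y$ on $S^6$ by $N(X,Y)=[JX,JY]-[X,Y]-J[X,JY]-J[JX,Y]$. Then for every $a\in S^{6}$ and all $b,c\in T_{a}S^{6}$, $$N_{a}(b,c)=2[a,b,c],$$ where $[a,b,c]:=(a\cdot b)\cdot c-a\cdot(b\cdot c)$ is the associator of $\mathbb{O}$.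
   Context: The octonions $\mathbb{O}\cong\mathbb{R}^{8}$ have the canonical basis $1,e_{1},\dots,e_{7}$, with $e_{i}e_{j}=-\delta_{ij}+\sum_{k}a_{ijk}e_{k}$, where the structure constants $a_{ijk}$ are totally antisymmetric; the product is alternative. Conjugation is defined by $\bar 1=1$, $\bar e_{i}=-e_{i}$ and $\overline{ab}=\bar b\,\bar a$, and the scalar product is $\langle a,b\rangle=\tfrac12(a\bar b+b\bar a)$. $\operatorname{Im}\mathbb{O}$ is the hyperplane orthogonal to $1$. For $a\in S^{6}$, right multiplication $R_{a}:\mathbb{O}\to\mathbb{O}$, $R_a(z)=z\cdot a$, is an orthogonal linear map with $R_{a}^{2}=-\mathrm{Id}$ which preserves the plane spanned by $1$ and $a$, hence also its orthogonal complement $T_{a}S^{6}$; this is why $J$ is an almost complex structure on $S^6$. The Lie bracket of vector fields $X,Y$ on $S^{6}$, regarded as maps $S^{6}\to\operatorname{Im}\mathbb{O}\cong\mathbb{R}^{7}$, follows the convention $[X,Y]=dY(X)-dX(Y)$. $N_a(b,c)$ denotes the value at $a$ of $N(X,Y)$ for any vector fields $X,Y$ with $X_a=b$, $Y_a=c$ (well defined since $N$ is a tensor). *)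

(* Defs.v *)
From HB Require Import structures.
From mathcomp Require Import all_boot all_order all_algebra.
From mathcomp Require Import all_classical all_reals all_analysis.

Set Implicit Arguments.
Unset Strict Implicit.
Unset Printing Implicit Defensive.

Import Order.TTheory GRing.Theory Num.Theory.
Import numFieldNormedType.Exports.

Local Open Scope classical_set_scope.
Local Open Scope ring_scope.

(* Coordinate 0 is the coefficient of 1, coordinate i (1 <= i <= 7) that of
   e_i. The library norm `|x| on this type is the sup norm; the Euclidean norm
   is [onorm] below. Both induce the same topology and differentials. *)
Notation octonion R := 'rV[R]_8.

Section Octonions.
Context {R : realType}.
Implicit Types (x y z a b c v : octonion R) (i j k : 'I_8).

Definition obase i : octonion R := delta_mx ord0 i.

Definition oone : octonion R := obase ord0.

(* The oriented lines (i, i+1, i+3) of the Fano plane, indices mod 7. *)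
Definition fano : seq (nat * nat * nat) :=
  [:: (1, 2, 4); (2, 3, 5); (3, 4, 6); (4, 5, 7);
      (5, 6, 1); (6, 7, 2); (7, 1, 3)]%N.

Definition fano_cyclic (i j k : nat) : bool :=
  [|| (i, j, k) \in fano, (j, k, i) \in fano | (k, i, j) \in fano].

(* The structure constants a_ijk: the totally antisymmetric tensor equal to 1
   on the oriented lines and 0 off the lines. *)
Definition ostruct (i j k : nat) : R :=
  (fano_cyclic i j k)%:R - (fano_cyclic j i k)%:R.

Definition obase_mul i j : octonion R :=
  if i == ord0 then obase j
  else if j == ord0 then obase i
  else - ((i == j)%:R *: oone)
       + \sum_(k < 8 | k != ord0) ostruct i j k *: obase k.

Definition omul x y : octonion R :=
  \sum_(i < 8) \sum_(j < 8) (x ord0 i * y ord0 j) *: obase_mul i j.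

Definition oassoc a b c : octonion R := omul (omul a b) c - omul a (omul b c).

Definition oconj x : octonion R :=
  \row_(i < 8) (if i == ord0 then x ord0 i else - x ord0 i).

(* (a * conj b + b * conj a) / 2 is a real multiple of 1, identified with its
   coefficient; in coordinates it is the sum of the a_i b_i. *)
Definition odot a b : R :=
  (2^-1 *: (omul a (oconj b) + omul b (oconj a))) ord0 ord0.

Definition onorm x : R := Num.sqrt (odot x x).

Definition ImO : set (octonion R) := [set x | odot x oone = 0].

Definition S6 : set (octonion R) := [set a | ImO a /\ onorm a = 1].

Definition TS6 a : set (octonion R) :=
  [set b | odot b oone = 0 /\ odot b a = 0].

(* C^infinity on the open set U: all iterated directional derivatives are
   differentiable at every point of U. *)
Definition smooth_on (U : set (octonion R)) (F : octonion R -> octonion R) :=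
  forall (vs : seq (octonion R)) x, U x ->
    differentiable (foldr (fun v G => fun y => 'D_v G y) F vs) x.

(* Maps on S^6 are represented by functions on O whose values outside S^6 are
   irrelevant. Smoothness on the submanifold S^6 is local smooth
   extendability. *)
Definition smooth_on_S6 (X : octonion R -> octonion R) :=
  forall a, S6 a -> exists U F,
    [/\ open U, U a, smooth_on U F & forall x, U x -> S6 x -> X x = F x].

Definition vector_field (X : octonion R -> octonion R) :=
  smooth_on_S6 X /\ forall a, S6 a -> TS6 a (X a).

Definition radial x : octonion R := (onorm x)^-1 *: x.

(* The differential dX_a(v) of a map X on S^6, for v tangent at a: the
   derivative at t = 0 of X along the curve t |-> (a + t v) / |a + t v| of
   S^6, which has velocity v at t = 0. By the chain rule it equals 'd F a v for
   every F differentiable at a that agrees with X on S^6 near a. *)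
Definition dS6 (X : octonion R -> octonion R) a v : octonion R :=
  'D_v (X \o radial) a.

Definition lie_bracket (X Y : octonion R -> octonion R) a : octonion R :=
  dS6 Y a (X a) - dS6 X a (Y a).

Definition J a b : octonion R := omul b a.

Definition Jfield (X : octonion R -> octonion R) a : octonion R := J a (X a).

Definition nijenhuis (X Y : octonion R -> octonion R) a : octonion R :=
  lie_bracket (Jfield X) (Jfield Y) a - lie_bracket X Y a
  - Jfield (lie_bracket X (Jfield Y)) a - Jfield (lie_bracket (Jfield X) Y) a.

(* "N_a(b, c) = n": vector fields with the values b and c at a exist, and n is
   the value at a of N(X, Y) for any such X and Y. *)
Definition nijenhuis_at_is a b c n :=
  (exists X Y, [/\ vector_field X, vector_field Y, X a = b & Y a = c]) /\
  (forall X Y, vector_field X -> vector_field Y -> X a = b -> Y a = c ->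
     nijenhuis X Y a = n).

End Octonions.

(* Main.v *)
Require Import Defs.
From mathcomp Require Import all_boot all_order all_algebra.
From mathcomp Require Import all_classical all_reals all_analysis.
From mathcomp Require Import ring.
Import Order.TTheory GRing.Theory Num.Theory.
Import numFieldNormedType.Exports.
Local Open Scope ring_scope.

Set Implicit Arguments.
Unset Strict Implicit.
Unset Printing Implicit Defensive.

(* Extend X and Y smoothly off the sphere and differentiate along the curves
   t |-> (a + t v) / |a + t v|. Right multiplication by the base point obeys the
   product rule d(JX)(v) = dX(v) a + X v, so in N(X, Y) all the terms containing
   a differential cancel, because (z a) a = - z; what remains is
   (X Y) a - X (Y a) - (Y X) a + Y (X a) = [X, Y, a] - [Y, X, a], which equals
   2 [a, X, Y] by antisymmetry of the associator. The field
   x |-> b - <x, b> x shows that every tangent vector b at a extends. *)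

(** * Octonion algebra in coordinates *)

Section OctonionAlgebra.
Context {R : realType}.
Implicit Types (x y z a b : octonion R).

(** Natural-number indices let coordinates be written with numerals and goals be split by cases on
    the index. *)
Definition ocoord x (n : nat) : R := x ord0 (inord n).
Local Notation "x $ n" := (ocoord x n)
  (at level 2, n at level 1, format "x $ n").

Lemma ocoordP x y : (forall n, (n < 8)%N -> x$n = y$n) -> x = y.
Proof.
move=> xy; apply/rowP => i.
by have := xy i (ltn_ord i); rewrite /ocoord inord_val.
Qed.

Lemma ocoord_row (s : seq R) n : (n < 8)%N -> (\row_(k < 8) s`_k)$n = s`_n.
Proof. by move=> n8; rewrite /ocoord mxE inordK. Qed.

Definition omul_struct (i j k : nat) : R :=
  if i == 0%N then (j == k)%:R
  else if j == 0%N then (i == k)%:R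
  else if k == 0%N then - (i == j)%:R else ostruct i j k.

Lemma ocoord_obase_mul (i j : 'I_8) k :
  (k < 8)%N -> (obase_mul i j : octonion R)$k = omul_struct i j k.
Proof.
move=> k8; rewrite /obase_mul /omul_struct /ocoord.
have eqk (i' : 'I_8) : (inord k == i') = (i' == k :> nat).
  by rewrite -val_eqE /= inordK // eq_sym.
rewrite -[i == ord0]/(i == 0 :> nat) -[j == ord0]/(j == 0 :> nat).
case: ifP => _; first by rewrite mxE eqxx /= eqk.
case: ifP => _; first by rewrite mxE eqxx /= eqk.
rewrite !mxE eqxx /= eqk summxE [_ == k]eq_sym.
case: ifP => [k0|kN0].
  rewrite mulr1 big1 ?addr0 // => l lN0; rewrite !mxE eqk /=.
  by move: lN0; rewrite -val_eqE /= (eqP k0) => /negPf ->; rewrite mulr0.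
rewrite mulr0 oppr0 add0r (bigD1 (inord k)) /=; last first.
  by rewrite -val_eqE /= inordK // kN0.
rewrite !mxE !eqxx mulr1 inordK // big1 ?addr0 // => l /andP[_ lk].
by rewrite !mxE eqxx eq_sym (negPf lk) mulr0.
Qed.

Lemma ocoord_omul_sum x y k : (k < 8)%N -> (omul x y)$k =
  \sum_(0 <= i < 8) \sum_(0 <= j < 8) x$i * y$j * omul_struct i j k.
Proof.
move=> k8; rewrite /ocoord summxE big_mkord; apply: eq_bigr => i _.
rewrite summxE big_mkord; apply: eq_bigr => j _.
by rewrite mxE -[X in _ * X]/(ocoord _ k) ocoord_obase_mul // !inord_val.
Qed.

(** The explicit multiplication table turns each octonion identity into eight polynomial identities
    that [ring] decides. *)
Lemma omulE x y : omul x y = \row_(k < 8) [::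
    x$0 * y$0 - x$1 * y$1 - x$2 * y$2 - x$3 * y$3
      - x$4 * y$4 - x$5 * y$5 - x$6 * y$6 - x$7 * y$7;
    x$0 * y$1 + x$1 * y$0 + x$2 * y$4 + x$3 * y$7
      - x$4 * y$2 + x$5 * y$6 - x$6 * y$5 - x$7 * y$3;
    x$0 * y$2 - x$1 * y$4 + x$2 * y$0 + x$3 * y$5
      + x$4 * y$1 - x$5 * y$3 + x$6 * y$7 - x$7 * y$6;
    x$0 * y$3 - x$1 * y$7 - x$2 * y$5 + x$3 * y$0
      + x$4 * y$6 + x$5 * y$2 - x$6 * y$4 + x$7 * y$1;
    x$0 * y$4 + x$1 * y$2 - x$2 * y$1 - x$3 * y$6
      + x$4 * y$0 + x$5 * y$7 + x$6 * y$3 - x$7 * y$5;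
    x$0 * y$5 - x$1 * y$6 + x$2 * y$3 - x$3 * y$2
      - x$4 * y$7 + x$5 * y$0 + x$6 * y$1 + x$7 * y$4;
    x$0 * y$6 + x$1 * y$5 - x$2 * y$7 + x$3 * y$4
      - x$4 * y$3 - x$5 * y$1 + x$6 * y$0 + x$7 * y$2;
    x$0 * y$7 + x$1 * y$3 + x$2 * y$6 - x$3 * y$1
      + x$4 * y$5 - x$5 * y$4 - x$6 * y$2 + x$7 * y$0
  ]`_k.
Proof.
apply: ocoordP => k k8; rewrite ocoord_omul_sum // ocoord_row //.
(* Once unlocked, the big sums and the structure constants compute for each concrete [k]; after
   eight cases the bound on [k] is absurd. *)
rewrite unlock /omul_struct /ostruct.
by do 8![case: k k8 => [_|k k8]; first by rewrite /=; ring].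
Qed.

Lemma ocoord0 x : x$0 = x ord0 ord0.
Proof.
by rewrite /ocoord; congr (x _ _); apply: val_inj; rewrite /= inordK.
Qed.

Lemma odot_ocoord x y : odot x y = \sum_(0 <= i < 8) x$i * y$i.
Proof.
have coord_oconj z n : (n < 8)%N ->
    (oconj z)$n = if n == 0%N then z$n else - z$n.
  by move=> n8; rewrite /ocoord mxE -val_eqE /= inordK.
rewrite /odot -ocoord0 [LHS]mxE [X in _ * X]mxE -!/(ocoord _ _).
rewrite !omulE !ocoord_row //= !coord_oconj //=.
by rewrite unlock /=; field.
Qed.

Lemma odotE x y : odot x y = \sum_(i < 8) x ord0 i * y ord0 i.
Proof.
rewrite odot_ocoord big_mkord; apply: eq_bigr => i _.
by rewrite /ocoord inord_val.
Qed.

Lemma odotC x y : odot x y = odot y x.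
Proof. by rewrite !odotE; apply: eq_bigr => i _; rewrite mulrC. Qed.

Lemma odotDl x y z : odot (x + y) z = odot x z + odot y z.
Proof.
by rewrite !odotE -big_split; apply: eq_bigr => i _; rewrite mxE mulrDl.
Qed.

Lemma odotZl (t : R) x y : odot (t *: x) y = t * odot x y.
Proof. by rewrite !odotE mulr_sumr; apply: eq_bigr => i _; rewrite mxE mulrA. Qed.

Lemma odot_ge0 x : 0 <= odot x x.
Proof. by rewrite odotE sumr_ge0 // => i _; rewrite -expr2 sqr_ge0. Qed.

Lemma onorm_sqr x : onorm x ^+ 2 = odot x x.
Proof. by rewrite sqr_sqrtr // odot_ge0. Qed.

Lemma omulxyy x y : omul (omul x y) y = omul x (omul y y).
Proof.
apply: ocoordP => k k8.
(* The outer products are expanded first, so that the inner ones occur only through their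
   coordinates. *)
rewrite (omulE (omul x y)) (omulE x (omul y y)) !ocoord_row //.
rewrite !(omulE x y) !(omulE y y) !ocoord_row //.
by do 8![case: k k8 => [_|k k8]; first by rewrite /=; ring].
Qed.

Lemma omulxxy x y : omul (omul x x) y = omul x (omul x y).
Proof.
apply: ocoordP => k k8.
rewrite (omulE (omul x x)) (omulE x (omul x y)) !ocoord_row //.
rewrite !(omulE x x) !(omulE x y) !ocoord_row //.
by do 8![case: k k8 => [_|k k8]; first by rewrite /=; ring].
Qed.

Lemma omulDl x y z : omul (x + y) z = omul x z + omul y z.
Proof.
rewrite /omul -big_split; apply: eq_bigr => i _.
rewrite -big_split; apply: eq_bigr => j _.
by rewrite mxE mulrDl scalerDl.
Qed.

Lemma omulDr x y z : omul x (y + z) = omul x y + omul x z.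
Proof.
rewrite /omul -big_split; apply: eq_bigr => i _.
rewrite -big_split; apply: eq_bigr => j _.
by rewrite mxE mulrDr scalerDl.
Qed.

Lemma omulNl x y : omul (- x) y = - omul x y.
Proof.
rewrite /omul -sumrN; apply: eq_bigr => i _.
rewrite -sumrN; apply: eq_bigr => j _.
by rewrite mxE mulNr scaleNr.
Qed.

Lemma oassocxyy x y : oassoc x y y = 0.
Proof. by rewrite /oassoc omulxyy subrr. Qed.

Lemma oassocxxy x y : oassoc x x y = 0.
Proof. by rewrite /oassoc omulxxy subrr. Qed.

Lemma oassocD1 x x' y z : oassoc (x + x') y z = oassoc x y z + oassoc x' y z.
Proof. by rewrite /oassoc !omulDl opprD addrACA. Qed.

Lemma oassocD2 x y y' z : oassoc x (y + y') z = oassoc x y z + oassoc x y' z.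
Proof. by rewrite /oassoc !(omulDl, omulDr) opprD addrACA. Qed.

Lemma oassocD3 x y z z' : oassoc x y (z + z') = oassoc x y z + oassoc x y z'.
Proof. by rewrite /oassoc !omulDr opprD addrACA. Qed.

(** Polarization of left alternativity: expand [oassoc (x + y) (x + y) z = 0]. *)
Lemma oassocC12 x y z : oassoc y x z = - oassoc x y z.
Proof.
have /eqP := oassocxxy (x + y) z.
rewrite oassocD1 !oassocD2 !oassocxxy add0r addr0.
by rewrite addrC addr_eq0 => /eqP.
Qed.

Lemma oassocC23 x y z : oassoc x z y = - oassoc x y z.
Proof.
have /eqP := oassocxyy x (y + z).
rewrite oassocD2 !oassocD3 !oassocxyy add0r addr0.
by rewrite addrC addr_eq0 => /eqP.
Qed.

Lemma odot_oone x : odot x oone = x ord0 ord0.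
Proof.
rewrite odotE (bigD1 ord0) //= big1 ?addr0 => [|i iN0].
  by rewrite mxE !eqxx mulr1.
by rewrite mxE (negPf iN0) andbF mulr0.
Qed.

Lemma ocoord_oone n : (n < 8)%N -> (oone : octonion R)$n = (n == 0%N)%:R.
Proof. by move=> n8; rewrite /ocoord mxE eqxx -val_eqE /= inordK. Qed.

Lemma omul_Im_sqr a : a ord0 ord0 = 0 -> omul a a = - odot a a *: oone.
Proof.
move=> a0; have a0' : a$0 = 0 by rewrite ocoord0.
apply: ocoordP => k k8; rewrite omulE ocoord_row // [RHS]mxE.
rewrite -[oone _ _]/(oone$k) ocoord_oone // odot_ocoord unlock.
by do 8![case: k k8 => [_|k k8]; first by rewrite /= ?a0'; ring].
Qed.

Lemma omul_re x y :
  omul x y ord0 ord0 = 2 * (x ord0 ord0 * y ord0 ord0) - odot x y.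
Proof.
rewrite -!ocoord0 odot_ocoord omulE ocoord_row // unlock /=; ring.
Qed.

(** Right multiplication by [y] scales the scalar product by [odot y y], and [y] is the image of
    [oone]. For imaginary [x] this makes [omul x y] orthogonal to [y]. *)
Lemma odot_omul x y : odot (omul x y) y = x ord0 ord0 * odot y y.
Proof.
rewrite -ocoord0 !odot_ocoord omulE unlock /= !ocoord_row //=; ring.
Qed.

Lemma omulx1 x : omul x oone = x.
Proof.
apply: ocoordP => k k8; rewrite omulE ocoord_row //.
rewrite !ocoord_oone //=.
by do 8![case: k k8 => [_|k k8]; first by rewrite /=; ring].
Qed.

Lemma omulxZ (r : R) x y : omul x (r *: y) = r *: omul x y.
Proof.
rewrite /omul scaler_sumr; apply: eq_bigr => i _.
rewrite scaler_sumr; apply: eq_bigr => j _.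
by rewrite mxE mulrCA scalerA.
Qed.

Lemma S6P a : S6 a <-> a ord0 ord0 = 0 /\ odot a a = 1.
Proof.
rewrite /S6 /ImO /= odot_oone /onorm; split=> -[-> /eqP aa]; split=> //.
  by rewrite -(sqr_sqrtr (odot_ge0 a)) (eqP aa) expr1n.
by rewrite (eqP aa) sqrtr1.
Qed.

Lemma TS6P a b : TS6 a b <-> b ord0 ord0 = 0 /\ odot b a = 0.
Proof. by rewrite /TS6 /= odot_oone. Qed.

Lemma omul_S6K a x : S6 a -> omul (omul x a) a = - x.
Proof.
by move=> /S6P[a0 aa]; rewrite omulxyy omul_Im_sqr // aa omulxZ omulx1 scaleN1r.
Qed.

End OctonionAlgebra.

(** * Coordinatewise differentiation of vector-valued maps *)

Section MatrixCalculus.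
Context {R : realType} {V : normedModType R}.

Lemma is_derive_rVP n (F : V -> 'rV[R]_n) x v (dF : 'rV[R]_n) :
  is_derive x v F dF <->
  forall i, is_derive x v (fun y => F y ord0 i) (dF ord0 i).
Proof.
split=> [[Fx FE] i|Fi].
  split; first exact: (derivable_mxP F x v).1 Fx ord0 i.
  by rewrite -FE derive_mx // mxE.
have Fx : derivable F x v.
  by apply/derivable_mxP => i j; rewrite ord1; have [] := Fi j.
split=> //; rewrite derive_mx //; apply/rowP => j; rewrite mxE.
by have [_ ->] := Fi j.
Qed.

Lemma differentiable_rV n (F : V -> 'rV[R]_n) x :
  (forall i, differentiable (fun y => F y ord0 i) x) -> differentiable F x.
Proof.
move=> Fi.
have -> : F = \sum_(i < n) (fun y => F y ord0 i *: delta_mx ord0 i).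
  by apply/funext => y; rewrite fct_sumE [LHS]row_sum_delta.
by apply: differentiable_sum => i; apply: differentiableZl.
Qed.

End MatrixCalculus.

(** * Product rules for octonion products, scalar products and scalings *)

Section OctonionCalculus.
Context {R : realType} {V : normedModType R}.

Lemma is_derive_omul (f g : V -> octonion R) x v df dg :
  is_derive x v f df -> is_derive x v g dg ->
  is_derive x v (fun y => omul (f y) (g y)) (omul df (g x) + omul (f x) dg).
Proof.
move=> /is_derive_rVP fx /is_derive_rVP gx; apply/is_derive_rVP => k.
pose m i j : R := obase_mul i j ord0 k.
have omulk y z : omul y z ord0 k =
    \sum_(i < 8) \sum_(j < 8) m i j * (y ord0 i * z ord0 j).
  rewrite summxE; apply: eq_bigr => i _; rewrite summxE.
  by apply: eq_bigr => j _; rewrite mxE mulrC.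
have -> : (fun y => omul (f y) (g y) ord0 k) = \sum_(i < 8) \sum_(j < 8)
    m i j *: ((fun y => f y ord0 i) * (fun y => g y ord0 j)).
  apply/funext => y; rewrite omulk fct_sumE; apply: eq_bigr => i _.
  by rewrite fct_sumE.
(* The derivative of the double sum is inferred by instances; only its value remains to be
   identified. *)
apply: is_derive_eq.
rewrite [RHS]mxE !omulk -big_split; apply: eq_bigr => i _.
rewrite -big_split; apply: eq_bigr => j _ /=.
rewrite -mulrDr; congr (_ * _).
by rewrite addrC; congr (_ + _); apply: mulrC.
Qed.

Lemma is_derive_odot (f g : V -> octonion R) x v df dg :
  is_derive x v f df -> is_derive x v g dg ->
  is_derive x v (fun y => odot (f y) (g y)) (odot df (g x) + odot (f x) dg).
Proof.
move=> /is_derive_rVP fx /is_derive_rVP gx.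
have -> : (fun y => odot (f y) (g y)) =
    \sum_(i < 8) ((fun y => f y ord0 i) * (fun y => g y ord0 i)).
  by apply/funext => y; rewrite odotE fct_sumE.
apply: is_derive_eq; rewrite !odotE -big_split; apply: eq_bigr => i _ /=.
by rewrite addrC; congr (_ + _); apply: mulrC.
Qed.

Lemma differentiable_odot (f g : V -> octonion R) x :
  differentiable f x -> differentiable g x ->
  differentiable (fun y => odot (f y) (g y)) x.
Proof.
move=> fx gx.
have -> : (fun y => odot (f y) (g y)) =
    \sum_(i < 8) ((fun y => f y ord0 i) * (fun y => g y ord0 i)).
  by apply/funext => y; rewrite odotE fct_sumE.
apply: differentiable_sum => i; apply: differentiableM.
  exact: (differentiable_comp fx (differentiable_coord _ _ _)).
exact: (differentiable_comp gx (differentiable_coord _ _ _)).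
Qed.

Lemma is_derive_scale n (k : V -> R) (f : V -> 'rV[R]_n) x v dk df :
  is_derive x v k dk -> is_derive x v f df ->
  is_derive x v (fun y => k y *: f y) (dk *: f x + k x *: df).
Proof.
move=> kx /is_derive_rVP fx; apply/is_derive_rVP => i.
have -> : (fun y => (k y *: f y) ord0 i) = k * (fun y => f y ord0 i).
  by apply/funext => y; rewrite mxE.
by apply: is_derive_eq; rewrite !mxE addrC; congr (_ + _); apply: mulrC.
Qed.

Lemma differentiable_scale n (k : V -> R) (f : V -> 'rV[R]_n) x :
  differentiable k x -> differentiable f x ->
  differentiable (fun y => k y *: f y) x.
Proof.
move=> kx fx; apply: differentiable_rV => i.
have -> : (fun y => (k y *: f y) ord0 i) = k * (fun y => f y ord0 i).
  by apply/funext => y; rewrite mxE.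
apply: differentiableM => //.
exact: (differentiable_comp fx (differentiable_coord _ _ _)).
Qed.

End OctonionCalculus.

(** * Differentiation on the sphere and the Nijenhuis tensor *)

Section SphereS6.
Context {R : realType}.
Implicit Types (x a b k r v : octonion R)
  (X Y : octonion R -> octonion R).

Lemma S6_onorm a : S6 a -> onorm a = 1.
Proof. by case. Qed.

Lemma radial_S6 a : S6 a -> radial a = a.
Proof. by move=> [_ a1]; rewrite /radial a1 invr1 scale1r. Qed.

Lemma S6_radial x : x ord0 ord0 = 0 -> onorm x != 0 -> S6 (radial x).
Proof.
move=> x0 nx; apply/S6P; split; first by rewrite mxE x0 mulr0.
rewrite /radial odotZl odotC odotZl -onorm_sqr mulrA -expr2 -exprMn.
by rewrite mulVf // expr1n.
Qed.

Lemma TS6_J a b : S6 a -> TS6 a b -> TS6 a (J a b).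
Proof.
move=> /S6P[a0 aa] /TS6P[b0 ba]; apply/TS6P; rewrite /J omul_re odot_omul.
by rewrite b0 ba !(mul0r, mulr0) subr0.
Qed.

(* Differentiating |x|^2 = <x, x> gives 2 |a| D_v|.|(a) = 2 <a, v> = 0. *)
Lemma is_derive_onorm a v : S6 a -> TS6 a v -> is_derive a v onorm 0.
Proof.
move=> Sa /TS6P[_ va]; have [_ aa] := (S6P a).1 Sa.
have dn : derivable onorm a v.
  apply: diff_derivable.
  apply: (@differentiable_comp _ _ _ _ (fun x => odot x x) Num.sqrt).
    by apply: differentiable_odot.
  (* The square root is taken at [odot a a = 1], away from its singularity at 0. *)
  by apply/derivable1_diffP; rewrite aa; have [] := @is_derive1_sqrt R 1 ltr01.
have /derivableP dn' := dn.
split=> //.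
have [_] := is_deriveM dn' dn'.
have -> : onorm * onorm = (fun x => odot x x) :> (octonion R -> R).
  by apply/funext => x; rewrite -onorm_sqr.
have [_ ->] := is_derive_odot (is_derive_id a v) (is_derive_id a v).
rewrite (odotC a) va addr0 (S6_onorm Sa) scale1r => /esym/eqP.
by rewrite -mulr2n mulrn_eq0 /= => /eqP.
Qed.

(** The factor [(onorm x)^-1] is 1 at [a] and stationary in tangent directions, so only the factor
    [x] contributes. *)
Lemma is_derive_radial a v : S6 a -> TS6 a v -> is_derive a v radial v.
Proof.
move=> Sa Tv; have dn := is_derive_onorm Sa Tv.
have na : onorm a != 0 by rewrite S6_onorm // oner_neq0.
have dV : is_derive a v (fun x => (onorm x)^-1) 0.
  split; first by apply: derivableV => //; case: dn.
  by rewrite deriveV //; case: dn => _ ->; rewrite scaler0.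
have := is_derive_scale dV (is_derive_id a v).
by rewrite S6_onorm // invr1 scale0r add0r scale1r.
Qed.

(* Only the line through a in the direction v matters, and near t = 0 the field
   agrees along its radial projection with a smooth local extension. *)
Lemma derivable_S6 X a v : smooth_on_S6 X -> S6 a -> TS6 a v ->
  derivable (X \o radial) a v.
Proof.
move=> smX Sa Tv; have [U [F [oU Ua smF XF]]] := smX _ Sa.
have [a0 aa] := (S6P a).1 Sa; have [v0 va] := (TS6P a v).1 Tv.
pose g (t : R) := radial (t *: v + a).
have g0 : g 0 = a by rewrite /g scale0r add0r radial_S6.
have dg : differentiable g 0.
  apply/derivable1_diffP/(derivable1P radial a v).1.
  by case: (is_derive_radial Sa Tv).
(* The curve is on the sphere for every [t], since the squared norm of [t *: v + a] is
   [t ^+ 2 * odot v v + 1 > 0]. *)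
have Sg t : S6 (g t).
  apply: S6_radial; first by rewrite !mxE v0 a0 mulr0 addr0.
  apply: contraTneq (oner_neq0 R) => n0; rewrite negbK.
  have : odot (t *: v + a) (t *: v + a) = t ^+ 2 * odot v v + 1.
    rewrite odotDl odotZl ![odot _ (t *: v + a)]odotC !odotDl !odotZl va.
    by rewrite (odotC a) va aa; ring.
  rewrite -onorm_sqr n0 expr0n /= => /esym/eqP.
  by rewrite gt_eqF // ltr_wpDl // mulr_ge0 ?sqr_ge0 ?odot_ge0.
apply/derivable1P.
apply: (@near_eq_derivable _ _ _ (F \o g)).
  have : \forall t \near (0 : R), U (g t).
    have := differentiable_continuous dg; apply; rewrite g0.
    exact: open_nbhs_nbhs.
  by apply: filterS => t Ut; rewrite /= -XF.
apply/derivable1_diffP/differentiable_comp => //.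
(* The empty list of directions gives differentiability of [F] itself. *)
by rewrite g0; apply: (smF [::]).
Qed.

(** Composed with [radial], the field [Jfield X] is the product of [X \o radial] and [radial], and
    the second factor has derivative [v]. *)
Lemma dS6_Jfield X a v : smooth_on_S6 X -> S6 a -> TS6 a v ->
  dS6 (Jfield X) a v = omul (dS6 X a v) a + omul (X a) v.
Proof.
move=> smX Sa Tv; have /derivableP dX := derivable_S6 smX Sa Tv.
have [_] := is_derive_omul dX (is_derive_radial Sa Tv).
by rewrite /= radial_S6.
Qed.

Lemma nijenhuisE X Y a : vector_field X -> vector_field Y -> S6 a ->
  nijenhuis X Y a = 2 *: oassoc a (X a) (Y a).
Proof.
move=> [smX TX] [smY TY] Sa; have TXa := TX _ Sa; have TYa := TY _ Sa.
(* The brackets also differentiate in the directions JX and JY, so these must be tangent. *)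
have TJX := TS6_J Sa TXa; have TJY := TS6_J Sa TYa.
rewrite /nijenhuis /Jfield /lie_bracket -!/(Jfield _) !dS6_Jfield // /Jfield.
(* Each associator on the right contributes one copy: [(X a, Y a, a)] is an even permutation of
   [(a, X a, Y a)], and [(Y a, X a, a)] an odd one. *)
have -> : 2 *: oassoc a (X a) (Y a) =
    oassoc (X a) (Y a) a - oassoc (Y a) (X a) a.
  rewrite (oassocC12 (X a) (Y a) a) opprK.
  rewrite (oassocC23 (X a) a) (oassocC12 a (X a)) opprK.
  by rewrite scaler_nat.
rewrite /J /oassoc !(omulDl, omulNl) !omul_S6K //.
by apply/rowP => i; rewrite !mxE; ring.
Qed.

(* A family of maps stable under directional derivatives, so that all its members
   are smooth; it contains the field x |-> b - <x, b> x. *)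
Definition quad_field b k r (s t : R) x :=
  k + s *: x + odot x b *: (r + t *: x).

Lemma differentiable_quad_field b k r s t x :
  differentiable (quad_field b k r s t) x.
Proof.
apply: differentiableD.
  by apply: differentiableD => //; apply: differentiableZ.
apply: differentiable_scale; first exact: differentiable_odot.
by apply: differentiableD => //; apply: differentiableZ.
Qed.

(** The derivative is [s *: v + odot v b *: (r + t *: x) + odot x b *: (t *: v)], regrouped by its
    dependence on [x]. *)
Lemma derive_quad_field b k r s t v : (fun x => 'D_v (quad_field b k r s t) x) =
  quad_field b (s *: v + odot v b *: r) (t *: v) (t * odot v b) 0.
Proof.
apply/funext => x.
have d1 := is_derive_odot (is_derive_id x v) (is_derive_cst b x v).
have d2 : is_derive x v (fun x => r + t *: x) (0 + t *: v).
  by apply: is_deriveD.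
have d3 : is_derive x v (fun x => k + s *: x) (0 + s *: v).
  by apply: is_deriveD.
have [_ ->] := is_deriveD d3 (is_derive_scale d1 d2).
have -> : odot x 0 = 0.
  by rewrite odotE big1 // => i _; rewrite mxE mulr0.
by rewrite /quad_field /cst; apply/rowP => i; rewrite !mxE; ring.
Qed.

Lemma smooth_quad_field b k r s t U : smooth_on U (quad_field b k r s t).
Proof.
move=> vs x _; suff [k' [r' [s' [t' ->]]]] : exists k' r' s' t',
    foldr (fun v G => fun y => 'D_v G y) (quad_field b k r s t) vs =
    quad_field b k' r' s' t' by exact: differentiable_quad_field.
elim: vs => [|v vs [k' [r' [s' [t' IH]]]]] /=; first by exists k, r, s, t.
by rewrite IH derive_quad_field; do 4!eexists.
Qed.

(** For a unit vector [x], this is the orthogonal projection of [b] onto the complement of [x]. *)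
Definition tangent_field b x := b - odot x b *: x.

Lemma vector_field_tangent b :
  b ord0 ord0 = 0 -> vector_field (tangent_field b).
Proof.
move=> b0; split=> [a Sa|a /S6P[a0 aa]].
  (* The formula makes sense on all of the octonions, so one global extension serves at every
     point. *)
  exists setT, (quad_field b b 0 0 (-1)); split=> //; first exact: openT.
    exact: smooth_quad_field.
  by move=> x _ _; apply/rowP => i; rewrite !mxE; ring.
apply/TS6P; split; first by rewrite !mxE a0 b0 mulr0 subr0.
by rewrite odotDl -scaleNr odotZl aa mulr1 odotC subrr.
Qed.

Lemma tangent_field_eq a b : TS6 a b -> tangent_field b a = b.
Proof. by move=> /TS6P[_ ba]; rewrite /tangent_field odotC ba scale0r subr0. Qed.

End SphereS6.

Theorem mainTheorem1 (R : realType) (a : octonion R) (ha : S6 a)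
  (b c : octonion R) (hb : TS6 a b) (hc : TS6 a c) :
  nijenhuis_at_is a b c (2 *: oassoc a b c).
Proof.
split=> [|X Y vX vY <- <-]; last exact: nijenhuisE.
have [b0 _] := (TS6P a b).1 hb; have [c0 _] := (TS6P a c).1 hc.
exists (tangent_field b), (tangent_field c).
by split; rewrite ?tangent_field_eq //; apply: vector_field_tangent.
Qed.
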